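(* Let $X$ be an infinite-dimensional real Banach space with norm $\|\cdot\|$. The following are equivalent. (a) $X$ has the Schur property. (b) $H_{\mathrm{lip}} = WH_{\mathrm{lip}}$; that is, for every Lipschitz function $f: X\to\mathbb{R}$ and every $x\in X$, $f$ is $H$-differentiable at $x$ if and only if $f$ is $WH$-differentiable at $x$. (c) $H_{\mathrm{dist}} = WH_{\mathrm{dist}}$; that is, for every distance function $f$ on $X$ and every $x\in X$, $f$ is $H$-differentiable at $x$ if and only if $f$ is $WH$-differentiable at $x$.
   Context: Let $\mathcal{B}$ be a bornology on $X$, i.e. a family of bounded subsets of $X$ whose union is $X$. A function $f: X\to\mathbb{R}$ is $\mathcal{B}$-differentiable at $x\in X$ if there is $\Lambda\in X^*$ such that for each $B\in\mathcal{B}$, $\frac{1}{t}\bigl[f(x+th)-f(x)-\langle\Lambda,th\rangle\bigr]\to 0$ as $t\downarrow 0$, uniformly for $h\in B$. The bornologies used here are $H$ (all norm compact subsets of $X$) and $WH$ (all weakly compact subsets of $X$). For locally Lipschitz functions, $H$-differentiability coincides with $G$-differentiability (Gateaux differentiability), where $G$ is the bornology of singletons. A distance function on $X$ is a function of the form $f(x)=d(x,C)=\inf_{c\in C}\|x-c\|$ with $C\subset X$ nonempty. $X$ has the Schur property if every weakly convergent sequence in $X$ is norm convergent (equivalently, $H=WH$). *)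

(* Defs.v *)
From HB Require Import structures.
From mathcomp Require Import all_boot all_order all_algebra.
From mathcomp Require Import all_classical all_reals all_analysis.

Set Implicit Arguments.
Unset Strict Implicit.
Unset Printing Implicit Defensive.

Import Order.TTheory GRing.Theory Num.Theory.
Import numFieldNormedType.Exports.

Local Open Scope classical_set_scope.
Local Open Scope ring_scope.

Definition infinite_dimensional (R : realType) (X : lmodType R) : Prop :=
  ~ exists (n : nat) (e : 'I_n -> X),
      forall x : X, exists a : 'I_n -> R, x = \sum_(i < n) a i *: e i.

Definition dual (R : realType) (X : normedModType R) : Type :=
  {L : {linear X -> R^o} | continuous L}.

(* The carrier X with the coarsest topology making every element of the
   dual continuous. *)
Definition weak_space (R : realType) (X : normedModType R) : topologicalType :=
  sup_topology (fun L : dual X =>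
    Topological.on (initial_topology (sval L : X -> R^o))).

Definition schur_property (R : realType) (X : normedModType R) : Prop :=
  forall u : nat -> X,
    (exists x : weak_space X, (u : nat -> weak_space X) @ \oo --> x) ->
    cvg (u @ \oo).

Definition bornology_H (R : realType) (X : normedModType R) : set (set X) :=
  [set A | compact A].

Definition bornology_WH (R : realType) (X : normedModType R) : set (set X) :=
  [set A | compact (A : set (weak_space X))].

(* B is an arbitrary family of subsets: that the members of a bornology are
   bounded and cover X plays no role in the definition. *)
Definition born_differentiable (R : realType) (X : normedModType R)
    (B : set (set X)) (f : X -> R^o) (x : X) : Prop :=
  exists L : dual X, forall A, B A ->
    {uniform A, (fun (t : R) (h : X) =>
       t^-1 *: (f (x + t *: h) - f x - sval L (t *: h))) @ 0^'+
       --> (fun _ : X => 0 : R^o)}.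

Definition distance_function (R : realType) (X : normedModType R)
    (f : X -> R^o) : Prop :=
  exists2 C : set X, C !=set0 &
    forall x, f x = inf [set `|x - c| | c in C].

(* Main.v *)
(* If X is Schur, a failure of uniformity on a weakly compact set is witnessed
   by a sequence of directions in that set; by Eberlein-Smulian and the Schur
   property a subsequence converges in norm, and together with its limit it is a
   norm compact set on which uniformity fails too.
   If X is not Schur, take a weakly null sequence (v_n) with |v_n| >= e, and let
   C be the complement of the balls of radius e/4(n+1) around v_n/(n+1). At the
   point v_n/(n+1) the distance to C is at least e/4(n+1), so d(., C) is not
   WH-differentiable at 0 along the weakly compact set {0, v_0, v_1, ...}. Every
   ray from 0 however avoids the balls near 0, hence d(., C), being 1-Lipschitz,
   has H-derivative 0 there. *)
From HB Require Import structures.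
Require Import Defs.
From mathcomp Require Import all_boot all_order all_algebra.
From mathcomp Require Import all_classical all_reals all_analysis.
From mathcomp Require Import lra.

Set Implicit Arguments.
Unset Strict Implicit.
Unset Printing Implicit Defensive.

Import Order.TTheory GRing.Theory Num.Theory.
Import numFieldNormedType.Exports.
Local Open Scope classical_set_scope.
Local Open Scope ring_scope.

(** * Sublinear functionals and the Hahn-Banach theorem *)

(** Homogeneity is asked for only as an inequality at positive scalars, which infima inherit
    directly; applying it to [t^-1] recovers equality. *)
Definition sublinear (R : realType) (V : lmodType R) (q : V -> R) : Prop :=
  (forall x y, q (x + y) <= q x + q y) /\
  (forall (t : R) x, 0 < t -> q (t *: x) <= t * q x).

Lemma sublinear0 (R : realType) (V : lmodType R) (q : V -> R) :
  sublinear q -> q 0 = 0.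
Proof.
move=> [qD qZ]; have := qD 0 0; have := qZ 2^-1 0 ltac:(lra).
rewrite scaler0 addr0; lra.
Qed.

Lemma sublinearZ (R : realType) (V : lmodType R) (q : V -> R) t x :
  sublinear q -> 0 <= t -> q (t *: x) = t * q x.
Proof.
move=> sq; rewrite le_eqVlt => /predU1P[<-|t0].
  by rewrite scale0r mul0r (sublinear0 sq).
case: (sq) => _ qZ; apply/eqP; rewrite eq_le qZ//=.
have tn0 : t != 0 by rewrite gt_eqF.
rewrite -ler_pdivlMl//; have := qZ t^-1 (t *: x).
by rewrite invr_gt0 scalerA mulVf// scale1r => /(_ t0).
Qed.

Lemma sublinear_ge (R : realType) (V : lmodType R) (q : V -> R) x :
  sublinear q -> - q (- x) <= q x.
Proof.
move=> sq; case: (sq) => qD _; have := qD x (- x).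
by rewrite subrr (sublinear0 sq); lra.
Qed.

(* Lowers q to its value -q(x0) at -x0: a minimal sublinear functional is
   unchanged by this operation, hence odd. *)
Definition lower_at (R : realType) (V : lmodType R) (q : V -> R) (x0 x : V) : R :=
  inf [set q (x + t *: x0) - t * q x0 | t in [set t | 0 <= t]].

Section LowerAt.
Context (R : realType) (V : lmodType R) (q : V -> R) (x0 : V).
Hypothesis sq : sublinear q.

Let S x := [set q (x + t *: x0) - t * q x0 | t in [set t | 0 <= t]].

Let S0 x : S x !=set0.
Proof. by exists (q (x + 0 *: x0) - 0 * q x0); exists 0 => /=. Qed.

Let Slb x : has_lbound (S x).
Proof.
exists (- q (- x)) => _ [t /= t0 <-].
have [qD _] := sq; have := qD (x + t *: x0) (- x).
by rewrite addrAC subrr add0r sublinearZ//; lra.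
Qed.

Lemma lower_at_le_at x (t : R) : 0 <= t ->
  lower_at q x0 x <= q (x + t *: x0) - t * q x0.
Proof. by move=> t0; apply: ge_inf; [exact: Slb|exists t]. Qed.

Lemma lower_at_le x : lower_at q x0 x <= q x.
Proof.
by have := lower_at_le_at x (lexx 0); rewrite scale0r addr0 mul0r subr0.
Qed.

Lemma lower_atN : lower_at q x0 (- x0) <= - q x0.
Proof.
have := lower_at_le_at (- x0) ler01.
by rewrite scale1r addNr (sublinear0 sq) mul1r sub0r.
Qed.

Lemma le_lower_at x (z : R) :
  (forall t : R, 0 <= t -> z <= q (x + t *: x0) - t * q x0) ->
  z <= lower_at q x0 x.
Proof.
move=> zS; rewrite /lower_at; apply: lb_le_inf; first exact: S0.
by move=> _ [t /= t0 <-]; exact: zS.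
Qed.

(** Parameters [t] and [u] for the two summands combine to [t + u]; under scaling by [s] the
    parameter [t] becomes [s * t]. *)
Lemma lower_at_sublinear : sublinear (lower_at q x0).
Proof.
have [qD qZ] := sq; split=> [x y|s x s0].
  rewrite -lerBlDr; apply: le_lower_at => t t0.
  rewrite lerBlDr [leRHS]addrC -lerBlDr; apply: le_lower_at => u u0.
  rewrite lerBlDr; apply: (le_trans (@lower_at_le_at _ (t + u) _)).
    exact: addr_ge0.
  have := qD (x + t *: x0) (y + u *: x0); rewrite addrACA -scalerDl; lra.
rewrite -ler_pdivrMl//; apply: le_lower_at => t t0.
rewrite ler_pdivrMl//; apply: (le_trans (@lower_at_le_at _ (s * t) _)).
  by rewrite mulr_ge0// ltW.
by rewrite -scalerA -scalerDr; have := qZ s (x + t *: x0) s0; lra.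
Qed.

End LowerAt.

(** Zorn's lemma: a nonempty chain is bounded by its pointwise infimum, which is finite because
    [- p (- x)] bounds every member from below. *)
Lemma minimal_sublinear (R : realType) (V : lmodType R) (p : V -> R) :
  sublinear p ->
  exists m, [/\ sublinear m, forall x, m x <= p x &
    forall q, sublinear q -> (forall x, q x <= m x) -> q = m].
Proof.
move=> sp; pose T := {q : V -> R | sublinear q /\ forall x, q x <= p x}.
(* The order is reversed, so that a maximal element is a minimal functional. *)
pose r (q1 q2 : T) := `[< forall x, sval q2 x <= sval q1 x >].
have [||||[m [sm mp]] mmin] := @Zorn T r.
- by move=> q; apply/asboolP.
- move=> a b c /asboolP ab /asboolP bc; apply/asboolP => x.
  exact: le_trans (bc x) (ab x).
- move=> [a Pa] [b Pb] /asboolP/= ab /asboolP/= ba; apply: eq_exist.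
  by apply/funext => x; apply/eqP; rewrite eq_le ab ba.
- move=> A Atot; have [->|/set0P[a Aa]] := eqVneq A set0.
    by exists (exist _ p (conj sp (fun x => lexx (p x)))).
  pose S x := [set sval q x | q in A].
  have S0 x : S x !=set0 by exists (sval a x), a.
  have Slb x : has_lbound (S x).
    exists (- p (- x)) => _ [[q [sq qp]] Aq <-] /=.
    by have := sublinear_ge x sq; have := qp (- x); lra.
  pose m x := inf (S x).
  have mle x q : A q -> m x <= sval q x.
    by move=> Aq; apply: ge_inf => //; exists q.
  have sm : sublinear m.
    split=> [x y|t x t0].
      rewrite -lerBlDr; apply: lb_le_inf => [//|] _ [q Aq <-].
      rewrite lerBlDr [leRHS]addrC -lerBlDr; apply: lb_le_inf => [//|] _ [q' Aq' <-].
      rewrite lerBlDr.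
      (* The members taken at [x] and at [y] may differ; the smaller of the two serves at both
         points. *)
      have [/asboolP qq'|/asboolP qq'] := Atot _ _ Aq Aq'.
        have := mle (x + y) _ Aq'; have := qq' x.
        by have [[+ _] _] := svalP q' => /(_ x y); lra.
      have := mle (x + y) _ Aq; have := qq' y.
      by have [[+ _] _] := svalP q => /(_ x y); lra.
    rewrite -ler_pdivrMl//; apply: lb_le_inf => [//|] _ [q Aq <-].
    rewrite ler_pdivrMl//; apply: (le_trans (mle _ _ Aq)).
    by have [[_ +] _] := svalP q; exact.
  have mp x : m x <= p x.
    by apply: (le_trans (mle x _ Aa)); have [_] := svalP a.
  by exists (exist _ m (conj sm mp)) => q Aq; apply/asboolP => x; exact: mle.
exists m; split=> // q sq qm.
have qp x : q x <= p x by exact: le_trans (qm x) (mp x).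
have := mmin (exist _ q (conj sq qp)).
by move=> /(_ (introT (asboolP _) qm)) [].
Qed.

(** A minimal [m] is odd, hence additive and linear. Starting below [lower_at p x0] rather than [p]
    forces [m (- x0) <= - p x0], which gives equality at [x0]. *)
Theorem Hahn_Banach (R : realType) (V : lmodType R) (p : V -> R) (x0 : V) :
  sublinear p ->
  exists2 phi : {linear V -> R^o}, (forall x, phi x <= p x) & phi x0 = p x0.
Proof.
move=> sp; have [m [sm mp mmin]] :=
  minimal_sublinear (lower_at_sublinear x0 sp).
(* By minimality [lower_at m x] is [m] itself, so [lower_atN] gives [m (- x) <= - m x]. *)
have modd x : m (- x) = - m x.
  have := lower_atN x sm; rewrite (mmin (lower_at m x)).
  - by have := sublinear_ge x sm; lra.
  - exact: lower_at_sublinear.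
  - by move=> y; exact: lower_at_le.
have mD x y : m (x + y) = m x + m y.
  have [mD _] := sm; apply/eqP; rewrite eq_le mD/=.
  by have := mD (x + y) (- y); rewrite addrK modd; lra.
have mlin : linear (m : V -> R^o).
  move=> a x y; rewrite mD; congr (_ + _).
  have [a0|/ltW a0] := leP 0 a; first exact: sublinearZ.
  rewrite -[a]opprK scaleNr modd sublinearZ ?oppr_ge0//.
  by rewrite /GRing.scale/= !mulNr.
pose phi : {linear V -> R^o} :=
  HB.pack (m : V -> R^o) (GRing.isLinear.Build R V R^o _ (m : V -> R^o) mlin).
exists phi => [x|].
  by apply: le_trans (mp x) _; exact: lower_at_le.
have mle x : m x <= p x by apply: le_trans (mp x) _; exact: lower_at_le.
apply/eqP; rewrite eq_le mle/=.
have := lower_atN x0 sp; have := mp (- x0); rewrite modd; lra.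
Qed.

(** * Distance to a set *)

Definition dist_to (R : realType) (X : normedModType R) (C : set X) (x : X) : R :=
  inf [set `|x - c| | c in C].

Section DistTo.
Context (R : realType) (X : normedModType R) (C : set X).

Lemma dist_to_le x c : C c -> dist_to C x <= `|x - c|.
Proof.
move=> Cc; apply: ge_inf; last by exists c.
by exists 0 => _ [d _ <-].
Qed.

Hypothesis C0 : C !=set0.

Lemma le_dist_to x (z : R) : (forall c, C c -> z <= `|x - c|) -> z <= dist_to C x.
Proof.
move=> zC; apply: lb_le_inf; first by have [c Cc] := C0; exists `|x - c|, c.
by move=> _ [c Cc <-]; exact: zC.
Qed.

Lemma dist_to_ge0 x : 0 <= dist_to C x.
Proof. exact: le_dist_to. Qed.

Lemma dist_to_lt x (e : R) : dist_to C x < e -> exists2 c, C c & `|x - c| < e.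
Proof.
move=> /inf_lt[|_ [c Cc <-] xce]; last by exists c.
by have [c Cc] := C0; exists `|x - c|, c.
Qed.

Lemma dist_to_lip x y : dist_to C x <= dist_to C y + `|x - y|.
Proof.
rewrite -lerBlDr; apply: le_dist_to => c Cc; rewrite lerBlDr.
apply: (le_trans (dist_to_le x Cc)).
by rewrite -(subrKA y) addrC ler_normD.
Qed.

Hypothesis CD : forall x y, C x -> C y -> C (x + y).
Hypothesis CZ : forall (a : R) x, C x -> C (a *: x).

Lemma dist_to_sublinear : sublinear (dist_to C).
Proof.
split=> [x y|t x t0].
  rewrite -lerBlDr; apply: le_dist_to => c Cc.
  rewrite lerBlDr [leRHS]addrC -lerBlDr; apply: le_dist_to => d Cd.
  rewrite lerBlDr; apply: (le_trans (dist_to_le _ (CD Cc Cd))).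
  by rewrite opprD addrACA addrC ler_normD.
rewrite -ler_pdivrMl//; apply: le_dist_to => c Cc.
rewrite ler_pdivrMl//; apply: (le_trans (dist_to_le _ (CZ t Cc))).
by rewrite -scalerBr normrZ gtr0_norm.
Qed.

End DistTo.

(** * Continuous functionals from Hahn-Banach *)

Lemma linear_le_norm_continuous (R : realType) (X : normedModType R)
  (phi : {linear X -> R^o}) : (forall x, phi x <= `|x|) -> continuous phi.
Proof.
move=> phi1; apply: bounded_linear_continuous; apply/linear_boundedP.
near=> r => x; apply: (@le_trans _ _ `|x|).
  rewrite ler_norml phi1 andbT lerNl -linearN -[leRHS]normrN; exact: phi1.
by rewrite ler_peMl//; near: r; apply: nbhs_pinfty_ge.
Unshelve. all: by end_near. Qed.

Lemma norming_functional (R : realType) (X : normedModType R) (x0 : X) :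
  exists2 L : dual X, (forall x, `|sval L x| <= `|x|) & sval L x0 = `|x0|.
Proof.
have [|phi phi1 phi0] := @Hahn_Banach R X (fun x => `|x|) x0.
  split=> [x y|t x t0]; first exact: ler_normD.
  by rewrite normrZ gtr0_norm.
exists (exist _ phi (linear_le_norm_continuous phi1)) => //= x.
rewrite ler_norml phi1 andbT lerNl -linearN -[leRHS]normrN; exact: phi1.
Qed.

(** A functional dominated by the distance to [Y] is nonpositive on [Y], hence zero there by passing
    to [- y]; since 0 lies in [Y], it is also dominated by the norm. *)
Lemma subspace_functional (R : realType) (X : normedModType R) (Y : set X)
    (x0 : X) : Y !=set0 ->
  (forall x y, Y x -> Y y -> Y (x + y)) ->
  (forall (a : R) x, Y x -> Y (a *: x)) ->
  exists2 L : dual X, (forall y, Y y -> sval L y = 0) &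
    sval L x0 = dist_to Y x0.
Proof.
move=> Y0 YD YZ.
have [phi phiY phi0] := Hahn_Banach x0 (dist_to_sublinear Y0 YD YZ).
have phi1 x : phi x <= `|x|.
  apply: (le_trans (phiY x)); have [y Yy] := Y0.
  by have := dist_to_le x (YZ 0 _ Yy); rewrite scale0r subr0.
have phi_le0 y : Y y -> phi y <= 0.
  move=> Yy; apply: (le_trans (phiY y)).
  by have := dist_to_le y Yy; rewrite subrr normr0.
exists (exist _ phi (linear_le_norm_continuous phi1)) => //= y Yy.
apply/eqP; rewrite eq_le phi_le0//= -oppr_le0 -linearN phi_le0//.
by rewrite -scaleN1r; exact: YZ.
Qed.

(** * The weak topology and compactness *)

Lemma cvg_initialP (S : choiceType) (T : topologicalType) (f : S -> T)
    (F : set_system S) (s : S) : Filter F ->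
  (F --> (s : initial_topology f)) <-> (f @ F --> f s).
Proof.
move=> FF; split=> [Fs A /(@initial_continuous _ _ f s)|Fs A].
  exact: Fs.
rewrite (@nbhsE (initial_topology f)) => -[_ [[B oB <-] Bs]] BA.
by apply: filterS BA _; apply: Fs; exact: open_nbhs_nbhs.
Qed.

Lemma cvg_weakP (R : realType) (X : normedModType R) (F : set_system X) (x : X) :
  Filter F ->
  (F --> (x : weak_space X)) <->
  (forall L : dual X, sval L @ F --> sval L x).
Proof.
move=> FF; split=> [Fx L|Fx].
  by apply/cvg_initialP; exact: (cvg_sup _ _ _).1 Fx L.
by apply/cvg_sup => L; apply/cvg_initialP; exact: Fx.
Qed.

Lemma weak_nbhs_nbhs (R : realType) (X : normedModType R) (x : X) (U : set X) :
  nbhs (x : weak_space X) U -> nbhs x U.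
Proof.
by move: U; apply: (cvg_weakP x (nbhs_filter x)).2 => L; exact: (svalP L).
Qed.

Lemma dual_weak_continuous (R : realType) (X : normedModType R) (L : dual X) :
  continuous (sval L : weak_space X -> R^o).
Proof.
by move=> x; apply: (cvg_weakP x (nbhs_filter (x : weak_space X))).1.
Qed.

Lemma compact_weak_compact (R : realType) (X : normedModType R) (A : set X) :
  compact A -> compact (A : set (weak_space X)).
Proof.
move=> cA F FF FA; have [x [Ax Fx]] := cA F FF FA.
by exists x; split=> // U V FU /weak_nbhs_nbhs; exact: Fx.
Qed.

(** If [F] does not cluster at [x], one of its members misses a neighbourhood of [x] containing all
    but finitely many terms, so [F] lives on a finite set. *)
Lemma compact_cvg_seq (T : topologicalType) (u : nat -> T) (x : T) :
  u @ \oo --> x -> compact ([set x] `|` range u).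
Proof.
move=> ux F FF FA; have [Fx|] := pselect (cluster F x).
  by exists x; split => //; left.
move=> /existsNP[U /existsNP[V /not_implyP[FU /not_implyP[Vx UV]]]].
have [N _ uN] := ux _ Vx.
pose B := u @` [set i | (i < N)%N].
have FB : F B.
  apply: filterS2 FA FU => y [->|[i _ <-]] Uy.
    by exfalso; apply: UV; exists x; split => //; exact: nbhs_singleton.
  have [iN|Ni] := ltnP i N; first by exists i.
  by exfalso; apply: UV; exists (u i); split => //; exact: uN.
have cB : compact B.
  by apply: finite_compact; apply: finite_image; exact: finite_II.
have [y [[i _ <-] Fy]] := cB F FF FB.
by exists (u i); split => //; right; exists i.
Qed.

(** Were a neighbourhood [U] of [x] not in [F], the trace of [F] on the complement of [U] would
    cluster in [A], necessarily at [x], which is absurd. *)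
Lemma compact_cvg_cluster1 (T : topologicalType) (A : set T) (F : set_system T)
    (x : T) : compact A -> Filter F -> F A ->
  (forall y, A y -> cluster F y -> y = x) -> F --> x.
Proof.
move=> cA FF FA Fx U Ux; apply: contrapT => nFU.
have PF : ProperFilter (within (~` U) F).
  apply: Build_ProperFilter; rewrite /within/= => FnU; apply: nFU.
  by apply: filterS FnU => z nUz; apply: contrapT => /nUz.
have [|y [Ay Fy]] := cA _ PF.
  by apply: filterS FA.
have yx : y = x.
  apply: Fx => // B V FB; apply: Fy; exact: filterS FB.
have [] := Fy (~` U) U.
- exact: withinT.
- by rewrite yx.
- by move=> z [].
Qed.

(** * Subsequences in weakly compact sets *)

(** With lists of pairs, sums become concatenations, and rational combinations form a countable type
    that [unpickle] enumerates. *)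
Definition lincomb (R : realType) (X : normedModType R) (u : nat -> X)
    (s : seq (nat * R)) : X := \sum_(p <- s) p.2 *: u p.1.

Lemma lincomb_rat_dense (R : realType) (X : normedModType R) (u : nat -> X)
    (s : seq (nat * R)) (e : R) : 0 < e ->
  exists s' : seq (nat * rat),
    `|lincomb u s - lincomb u [seq (p.1, ratr p.2) | p <- s']| < e.
Proof.
elim: s e => [|[i a] s IH] e e0.
  by exists [::]; rewrite subrr normr0.
have [s' ss'] := IH (e / 2) ltac:(lra).
(* The [+ 1] keeps the divisor positive when [u i] is zero. *)
pose M := `|u i| + 1; have M0 : 0 < M by rewrite ltr_wpDl.
have [|q] := @rat_in_itvoo R a (a + e / 2 / M).
  by rewrite ltrDl !divr_gt0.
rewrite in_itv/= => /andP[aq qa].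
exists ((i, q) :: s'); rewrite /lincomb/= !big_cons/= opprD addrACA.
apply: (le_lt_trans (ler_normD _ _)); rewrite -scalerBl normrZ.
rewrite [ltRHS](splitr e) ler_ltD// distrC ger0_norm ?subr_ge0 ?(ltW aq)//.
have : (ratr q - a) * `|u i| <= (ratr q - a) * M.
  by rewrite ler_wpM2l ?subr_ge0 ?(ltW aq)// /M lerDl.
by move/le_trans; apply; rewrite -ler_pdivlMr// lerBlDl ltW.
Qed.

Lemma weak_cluster_seq (R : realType) (X : normedModType R) (u : nat -> X)
    (y : X) (L : dual X) (l : R^o) :
  cluster (u @ \oo : set_system (weak_space X)) y ->
  sval L \o u @ \oo --> l -> sval L y = l.
Proof.
move=> uy ul; apply/eqP; rewrite -subr_eq0; apply: contrapT => /negP Lyl.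
pose e := `|sval L y - l| / 2.
have e0 : 0 < e by rewrite divr_gt0// normr_gt0.
have /cvgrPdist_lt/(_ _ e0) yU := @dual_weak_continuous R X L y.
have /cvgrPdist_lt/(_ _ e0) lV := ul.
have uV : (u @ \oo) (u @` [set n | `|l - sval L (u n)| < e]).
  by apply: filterS lV => n /= ?; exists n.
have [_ [[n /= ln <-] /= yn]] := uy _ _ uV yU.
rewrite distrC in ln.
by have := le_lt_trans (ler_distD _ _ _) (ltrD yn ln); rewrite -splitr ltxx.
Qed.

Lemma weak_nbhs_finite (R : realType) (X : normedModType R) (h : X)
    (phi : nat -> dual X) (e : R) (m : nat) : 0 < e ->
  nbhs (h : weak_space X)
    [set z | forall k, (k < m)%N -> `|sval (phi k) h - sval (phi k) z| < e].
Proof.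
move=> e0; elim: m => [|m IH]; first by apply: filterS filterT.
have /cvgrPdist_lt/(_ _ e0) hm := @dual_weak_continuous R X (phi m) h.
apply: filterS2 hm IH => z zm zlt k.
by rewrite ltnS leq_eqVlt => /predU1P[->//|]; exact: zlt.
Qed.

(* The half of the Eberlein-Smulian theorem that is needed: countably many
   functionals norming the rational span of the sequence separate its closed
   span, in which all weak cluster points lie. *)
Lemma weak_compact_subseq (R : realType) (X : normedModType R) (A : set X)
    (u : nat -> X) : compact (A : set (weak_space X)) -> (forall n, A (u n)) ->
  exists2 g : nat -> nat, (forall n, (n <= g n)%N) &
    exists h : weak_space X, (u \o g : nat -> weak_space X) @ \oo --> h.
Proof.
move=> cA Au; pose D s := lincomb u [seq (p.1, ratr p.2) | p <- s].
pose d k := if unpickle k is Some s then D s else 0.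
have /choice[phi phiP] : forall k, exists L : dual X,
    (forall x, `|sval L x| <= `|x|) /\ sval L (d k) = `|d k|.
  by move=> k; have [L] := norming_functional (d k); exists L.
have FuA : (u @ \oo) A by exists 0%N => // n _; exact: Au.
have [h [Ah uh]] := cA (u @ \oo : set_system (weak_space X)) _ FuA.
(* Diagonal choice: at index [g j] the first [j+1] functionals are [1/(j+1)]-close to their values
   at the cluster point [h], so every [phi k] converges along [g]. *)
have /choice[g gP] : forall j, exists n, (j <= n)%N /\ forall k, (k < j.+1)%N ->
    `|sval (phi k) h - sval (phi k) (u n)| < j.+1%:R^-1.
  move=> j.
  have uV : (u @ \oo) (u @` [set n | (j <= n)%N]).
    by exists j => //= n jn; exists n.
  have j0 : 0 < j.+1%:R^-1 :> R by rewrite invr_gt0.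
  have [_ [[n jn <-] nh]] := uh _ _ uV (weak_nbhs_finite h phi j.+1 j0).
  by exists n.
exists g; first by move=> n; have [] := gP n.
have cvg_phi k : sval (phi k) \o (u \o g) @ \oo --> sval (phi k) h.
  apply/cvgrPdist_lt => e e0.
  have /cvgrPdist_lt/(_ _ e0)[N _ he] := @cvg_harmonic R.
  exists (maxn N k) => // n; rewrite /= geq_max => /andP[/he Nn kn].
  rewrite sub0r normrN ger0_norm ?harmonic_ge0// in Nn.
  by apply: lt_trans Nn; have [_] := gP n; exact.
(* It remains to see that [h] is the only weak cluster point of the subsequence in [A]. *)
exists h; apply: (compact_cvg_cluster1 cA).
  by exists 0%N => // n _; exact: Au.
move=> y Ay uy; pose Y := range (lincomb u).
have Yu n : Y (u n).
  by exists [:: (n, 1)] => //; rewrite /lincomb big_seq1 scale1r.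
have phi0 k : sval (phi k) (y - h) = 0.
  by rewrite linearB/= (weak_cluster_seq uy (cvg_phi k)) subrr.
(* A functional vanishing on the span also vanishes at the weak cluster points [y] and [h], so
   [y - h] has distance 0 to the span. *)
have [|||L LY Lyh] := @subspace_functional R X Y (y - h).
- by exists (u 0%N).
- move=> _ _ [s _ <-] [s' _ <-]; exists (s ++ s') => //.
  by rewrite /lincomb big_cat.
- move=> a _ [s _ <-]; exists [seq (p.1, a * p.2) | p <- s] => //.
  rewrite /lincomb big_map scaler_sumr.
  by apply: eq_bigr => p _; rewrite scalerA.
have Lcst (v : nat -> X) : (forall n, Y (v n)) -> sval L \o v @ \oo --> (0 : R^o).
  move=> Yv; rewrite (_ : _ \o _ = cst 0); first exact: cvg_cst.
  by apply/funext => n /=; exact: LY.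
have dyh : dist_to Y (y - h) = 0.
  rewrite -Lyh linearB/= (weak_cluster_seq uh (Lcst _ _))//.
  by rewrite (weak_cluster_seq uy (Lcst _ _)) ?subrr// => n; exact: Yu.
apply/eqP; rewrite -subr_eq0 -normr_eq0 eq_le normr_ge0 andbT leNgt.
(* [D s'] will be within [2e] of [w], and its norming functional kills [w], so
   [|D s'| <= |D s' - w| < 2e]; then [|w| < 4e = |w|]. *)
apply/negP => yh0; set w := y - h in phi0 dyh yh0; pose e := `|w| / 4.
have e0 : 0 < e by rewrite divr_gt0.
have [||_ [s _ <-] ws] := @dist_to_lt R X Y _ w e.
- by exists (u 0%N).
- by rewrite dyh.
have [s' ss'] := lincomb_rat_dense u s e0.
have wd : `|w - D s'| < e + e.
  by apply: le_lt_trans (ltrD ws ss'); exact: ler_distD.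
have [phi1 phid] := phiP (pickle s').
have := phi1 (D s' - w); rewrite linearB/= phi0 subr0.
move: phid; rewrite /d pickleK => ->; rewrite normr_id distrC => Dw.
have := ler_distD (D s') w 0; rewrite !subr0 => wD.
by move: wd Dw wD; rewrite /e; lra.
Qed.

(** * Differentiability along a bornology *)

Lemma uniform_at_rightP (R : realType) (X : normedModType R) (A : set X)
    (G : R -> X -> R^o) :
  {uniform A, G @ 0^'+ --> (fun _ : X => 0 : R^o)} <->
  (forall e : R, 0 < e -> exists2 d : R, 0 < d &
    forall t, 0 < t -> t < d -> forall h, A h -> `|G t h| < e).
Proof.
split=> [cG e e0|cG P /uniform_nbhs[E [entE EP]]].
  have [|d /= d0 dG] := cG [set g | forall h, A h -> `|g h| < e].
    apply/uniform_nbhs; exists [set xy | ball xy.1 e xy.2]; split.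
      exact: entourage_ball (PosNum e0).
    by move=> g /= gE h Ah; have := gE h Ah; rewrite /ball/= sub0r normrN.
  exists d => // t t0 td; apply: dG => //=.
  by rewrite sub0r normrN gtr0_norm.
move: entE; rewrite -entourage_ballE => -[e /= e0 eE].
have [d d0 dG] := cG e e0.
exists d => //= t; rewrite /ball/= sub0r normrN => td t0; apply: EP => h Ah.
apply: eE; rewrite /= /ball/= sub0r normrN; apply: dG => //.
by rewrite gtr0_norm in td.
Qed.

Lemma born_differentiableP (R : realType) (X : normedModType R)
    (B : set (set X)) (f : X -> R^o) (x : X) :
  born_differentiable B f x <->
  exists L : dual X, forall A, B A -> forall e : R, 0 < e ->
    exists2 d : R, 0 < d & forall t, 0 < t -> t < d -> forall h, A h ->
      `|t^-1 * (f (x + t *: h) - f x - sval L (t *: h))| < e.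
Proof.
by split=> -[L LB]; exists L => A BA; apply/uniform_at_rightP; exact: LB.
Qed.

Lemma WH_differentiable_H (R : realType) (X : normedModType R) (f : X -> R^o)
    (x : X) : born_differentiable (@bornology_WH R X) f x ->
  born_differentiable (@bornology_H R X) f x.
Proof.
by move=> [L LB]; exists L => A /compact_weak_compact; exact: LB.
Qed.

Lemma schur_H_differentiable_WH (R : realType) (X : normedModType R)
    (f : X -> R^o) (x : X) : schur_property X ->
  born_differentiable (@bornology_H R X) f x ->
  born_differentiable (@bornology_WH R X) f x.
Proof.
move=> schur /born_differentiableP[L LH]; apply/born_differentiableP; exists L.
move=> A cA e e0; apply: contrapT => nd.
have /choice[th thP] : forall n : nat, exists th : R * X,
    [/\ 0 < th.1, th.1 < n.+1%:R^-1, A th.2 &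
      e <= `|th.1^-1 * (f (x + th.1 *: th.2) - f x - sval L (th.1 *: th.2))|].
  move=> n; apply: contrapT => nth; apply: nd; exists n.+1%:R^-1 => // t t0 tn h Ah.
  by rewrite ltNge; apply/negP => eG; apply: nth; exists (t, h).
have Ah n : A (th n).2 by have [] := thP n.
have [g gn gh] := weak_compact_subseq cA Ah.
have /cvg_ex[y hy] := schur _ gh.
have [d d0 dK] := LH _ (compact_cvg_seq hy) e e0.
(* Since [N <= g N], the time of index [g N] is below [1/(N+1) < d], so that pair contradicts
   uniformity. *)
have /cvgrPdist_lt/(_ _ d0)[N _ /(_ N (leqnn N))/=] := @cvg_harmonic R.
rewrite sub0r normrN ger0_norm ?harmonic_ge0// => Nd.
have [t0 tg _] := thP (g N); apply/negP; rewrite -ltNge; apply: dK => //.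
  apply: (lt_trans tg); apply: le_lt_trans Nd.
  by rewrite lef_pV2 ?posrE// ler_nat ltnS.
by right; exists N.
Qed.

Lemma distance_function_lipschitz (R : realType) (X : normedModType R)
  (f : X -> R^o) : distance_function f -> lipschitz f.
Proof.
move=> [C C0 fC]; rewrite /lipschitz_on; near=> M => -[x y] _ /=.
rewrite /self_sub/= !fC -!/(dist_to C _); apply: (@le_trans _ _ `|x - y|).
  have := dist_to_lip C0 x y; have := dist_to_lip C0 y x.
  by rewrite (distrC y) ler_norml; lra.
by rewrite ler_peMl//; near: M; apply: nbhs_pinfty_ge.
Unshelve. all: by end_near. Qed.

(** * Bumps along a weakly null sequence *)

(** A sequence not converging in norm to its weak limit [x] is at distance at least [e] from [x] at
    arbitrarily late indices; these terms minus [x] give [v]. *)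
Lemma not_schur_weakly_null (R : realType) (X : normedModType R) :
  ~ schur_property X ->
  exists (v : nat -> X) (e : R), [/\ 0 < e, forall n, e <= `|v n| &
    forall L : dual X, sval L \o v @ \oo --> (0 : R^o)].
Proof.
move=> /existsNP[u /not_implyP[[x ux] nu]].
have [e e0 ue] : exists2 e : R, 0 < e &
    forall N, exists n, (N <= n)%N /\ e <= `|u n - x|.
  apply: contrapT => ne; apply: nu; apply/cvg_ex; exists x.
  apply/cvgrPdist_lt => e e0; apply: contrapT => nN; apply: ne; exists e => // N.
  apply: contrapT => nn; apply: nN; exists N => // n /= Nn.
  rewrite distrC ltNge; apply/negP => eu; apply: nn; by exists n.
have [g gP] := choice ue.
exists (fun n => u (g n) - x), e; split=> // [n|L]; first by have [] := gP n.
have Lu : sval L \o u @ \oo --> sval L x by exact: (cvg_weakP x _).1 ux L.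
move/cvgrPdist_lt in Lu; apply/cvgrPdist_lt => d /Lu[N _ uN]; exists N => // n /= Nn.
have [gn _] := gP n; have := uN _ (leq_trans Nn gn).
by rewrite linearB/= sub0r opprB.
Qed.

(* The complement of the balls of radius e / 4(n+1) around v_n / (n+1). *)
Definition bump_complement (R : realType) (X : normedModType R) (v : nat -> X)
    (e : R) : set X :=
  [set z : X | forall n, e / 4 <= `|n.+1%:R *: z - v n|].

Section Bumps.
Context (R : realType) (X : normedModType R) (v : nat -> X) (e : R).
Hypotheses (e0 : 0 < e) (ve : forall n, e <= `|v n|).
Hypothesis v0 : forall L : dual X, sval L \o v @ \oo --> (0 : R^o).

Local Notation C := (bump_complement v e).

Let C0 : C 0.
Proof. by move=> n; rewrite scaler0 sub0r normrN; apply: le_trans (ve n); have := e0; lra. Qed.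

Lemma bump_complement_nonempty : C !=set0.
Proof. by exists 0. Qed.

Let Cn0 := bump_complement_nonempty.

Let dist0 : dist_to C 0 = 0.
Proof.
apply/eqP; rewrite eq_le dist_to_ge0// andbT.
by have := dist_to_le 0 C0; rewrite subr0 normr0.
Qed.

(** The factor [n+1] makes this the difference quotient at time [1/(n+1)] in direction [v n]. *)
Lemma bump_ge n : e / 4 <= n.+1%:R * dist_to C (n.+1%:R^-1 *: v n).
Proof.
rewrite -ler_pdivrMl//; apply: le_dist_to => // c Cc.
rewrite ler_pdivrMl//; apply: (le_trans (Cc n)).
rewrite -[X in X * _]gtr0_norm// -normrZ scalerBr scalerA.
by rewrite divff ?pnatr_eq0// scale1r distrC.
Qed.

(* If th lay in the n-th ball, then v n would be within e/4 of the ray through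
   h, so that a functional norming h would be at least e/2 at v n. *)
Lemma bump_ray h : exists2 d : R, 0 < d &
  forall t, 0 < t -> t < d -> dist_to C (t *: h) = 0.
Proof.
have [L L1 Lh] := norming_functional h.
have /cvgrPdist_lt/(_ (e / 2))[|N _ LN] := v0 L; first by rewrite divr_gt0.
have Nh : 0 < N%:R * `|h| + 1 by rewrite ltr_wpDl// mulr_ge0.
(* Meeting the n-th ball would force [3e/4 <= (n+1) t |h|] and [n < N], hence [3e/4 <= N t |h|],
   which this bound on [t] excludes. The [+ 1] avoids a zero divisor. *)
exists (3 * e / 4 / (N%:R * `|h| + 1)); first by rewrite !divr_gt0// mulr_gt0.
move=> t t0; rewrite ltr_pdivlMr// => td.
suff Cth : C (t *: h).
  apply/eqP; rewrite eq_le dist_to_ge0// andbT.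
  by have := dist_to_le (t *: h) Cth; rewrite subrr normr0.
move=> n; rewrite leNgt scalerA; apply/negP => thn.
have Lsh : sval L ((n.+1%:R * t) *: h) = n.+1%:R * t * `|h|.
  by rewrite linearZ/= Lh.
have nt0 : 0 <= n.+1%:R * t by rewrite mulr_ge0// ltW.
have sh : 3 * e / 4 <= n.+1%:R * t * `|h|.
  have := lerB_dist (v n) (v n - (n.+1%:R * t) *: h).
  rewrite subKr distrC normrZ ger0_norm//; have := ve n.
  have := lerB_dist (v n) ((n.+1%:R * t) *: h).
  rewrite normrZ ger0_norm// (distrC (v n)).
  move: thn; lra.
have Lvn : e / 2 <= sval L (v n).
  have := ler_norm (sval L ((n.+1%:R * t) *: h - v n)).
  have := L1 ((n.+1%:R * t) *: h - v n).
  rewrite linearB/= Lsh; lra.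
have nN : (n < N)%N.
  rewrite ltnNge; apply/negP => /LN; rewrite /= sub0r normrN.
  by have := ler_norm (sval L (v n)); lra.
have : n.+1%:R * t * `|h| <= N%:R * t * `|h|.
  by rewrite ler_wpM2r// ler_wpM2r ?ler_nat// ltW.
by rewrite (mulrC _ t) -mulrA; move: td t0; rewrite mulrDr mulr1; lra.
Qed.

(** Compactness makes the vanishing along rays uniform: directions violating uniformity cluster at
    some [h], and by the 1-Lipschitz bound the distance at [t *: k] is at most [t * |k - h|] once it
    vanishes at [t *: h]. *)
Lemma bumps_H_differentiable :
  born_differentiable (@bornology_H R X) (dist_to C) 0.
Proof.
apply/born_differentiableP.
have c0 : continuous (\0 : X -> R^o) by move=> x; exact: cvg_cst.
exists (exist _ (\0 : {linear X -> R^o}) c0) => K cK eps eps0.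
apply: contrapT => nd.
have /choice[th thP] : forall n : nat, exists th : R * X,
    [/\ 0 < th.1, th.1 < n.+1%:R^-1, K th.2 &
      th.1 * eps <= dist_to C (th.1 *: th.2)].
  move=> n; apply: contrapT => nth; apply: nd; exists n.+1%:R^-1 => // t t0 tn h Kh.
  rewrite add0r dist0 /= !subr0 normrM gtr0_norm ?invr_gt0//.
  rewrite ger0_norm ?dist_to_ge0// ltr_pdivrMl// ltNge.
  by apply/negP => eG; apply: nth; exists (t, h).
have FK : ((fun n => (th n).2) @ \oo) K.
  by exists 0%N => // n _; have [] := thP n.
have [h [Kh hcl]] := cK _ _ FK.
have [d d0 dh] := bump_ray h.
have /cvgrPdist_lt/(_ _ d0)[N _ Nd] := @cvg_harmonic R.
have FN : ((fun n => (th n).2) @ \oo) ((fun n => (th n).2) @` [set n | (N <= n)%N]).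
  by exists N => // n Nn; exists n.
have [_ [[n Nn <-]]] := hcl _ _ FN (nbhsx_ballx h eps eps0).
rewrite -ball_normE/= => hn.
have [t0 tn _] := thP n; apply/negP; rewrite -ltNge.
apply: (le_lt_trans (dist_to_lip Cn0 _ ((th n).1 *: h))).
rewrite dh//.
  by rewrite add0r -scalerBr normrZ gtr0_norm// ltr_pM2l// distrC.
apply: (lt_trans tn); have := Nd _ Nn.
by rewrite /= sub0r normrN ger0_norm ?harmonic_ge0.
Qed.

(** The candidate [L] is arbitrary, but [sval L (v n)] tends to 0. Once it is below [e / 8] in
    absolute value, the quotient at time [1/(n+1)] in direction [v n] exceeds
    [e / 4 - e / 8 = e / 8]. *)
Lemma bumps_not_WH_differentiable :
  ~ born_differentiable (@bornology_WH R X) (dist_to C) 0.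
Proof.
move=> /born_differentiableP[L LWH].
have vw : (v : nat -> weak_space X) @ \oo --> (0 : weak_space X).
  by apply/cvg_weakP => M; rewrite linear0; exact: v0.
have e8 : 0 < e / 8 by rewrite divr_gt0.
have [d d0 dv] := LWH _ (compact_cvg_seq vw) _ e8.
have /cvgrPdist_lt/(_ _ d0)[N _ Nd] := @cvg_harmonic R.
have /cvgrPdist_lt/(_ _ e8)[M _ LM] := v0 L.
pose n := maxn N M.
have n1 : 0 < n.+1%:R^-1 :> R by rewrite invr_gt0.
have nd : n.+1%:R^-1 < d.
  have := Nd _ (leq_maxl N M).
  by rewrite /= sub0r normrN ger0_norm ?harmonic_ge0.
have := dv _ n1 nd (v n) (or_intror (ex_intro2 _ _ n I erefl)).
have := LM _ (leq_maxr N M); rewrite /= sub0r normrN -/n.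
rewrite add0r dist0 subr0 invrK linearZ/= mulrBr.
have -> : n.+1%:R * (n.+1%:R^-1 *: sval L (v n)) = sval L (v n).
  by apply: mulVKf; rewrite pnatr_eq0.
by rewrite !ltr_norml; have := bump_ge n; have := e0; lra.
Qed.

End Bumps.

Theorem theorem2p3 (R : realType) (X : completeNormedModType R)
    (Xinf : infinite_dimensional X) :
  [<-> schur_property X;
       forall (f : X -> R^o) (x : X), lipschitz f ->
         (born_differentiable (@bornology_H R X) f x <->
         born_differentiable (@bornology_WH R X) f x);
       forall (f : X -> R^o) (x : X), distance_function f ->
         (born_differentiable (@bornology_H R X) f x <->
         born_differentiable (@bornology_WH R X) f x)].
Proof.
split=> [schur f x _|].
  split; [exact: schur_H_differentiable_WH|exact: WH_differentiable_H].
split=> [lip f x /distance_function_lipschitz|dist]; first exact: lip.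
apply: contrapT => /not_schur_weakly_null[v [e [e0 ve v0]]].
apply: (bumps_not_WH_differentiable e0 ve v0).
apply/dist; last exact: bumps_H_differentiable.
by exists (bump_complement v e) => //; exact: bump_complement_nonempty.
Qed.
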